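(* Let $(G,E,\varphi)$ be a self-similar triple and suppose that $E$ is finite. Let $R$ be a unital commutative ring, equipped with the trivial involution. Then $\mathcal{O}_{(G,E)}^{\text{alg}}(R)\cong L_R(G,E)$ as $*$-algebras over $R$.
   Context: A $*$-algebra over a commutative unital ring $R$ with involution $r\mapsto r^*$ (here $r^*=r$) is an (associative, not necessarily unital) $R$-algebra with a map $a\mapsto a^*$ satisfying $(a^* )^*=a$, $(ab)^*=b^*a^*$, $(ra+b)^*=r^*a^*+b^*$. A projection is $p=p^*=p^2$; a partial isometry is $s=ss^*s$. A directed graph $E=(E^0,E^1,r,s)$ has vertex set $E^0$, edge set $E^1$ and maps $r,s\colon E^1\to E^0$; $E$ is finite if $E^0,E^1$ are finite; $vE^1:=r^{-1}(v)$; $E$ has no sources if $vE^1\neq\emptyset$ for all $v$. An action of a group $G$ on $E$ is a homomorphism from $G$ to the group of bijections of $E^0\sqcup E^1$ that preserve $E^0$ and $E^1$ and commute with $r$ and $s$. A self-similar triple $(G,E,\varphi)$: a countable discrete group $G$ (unit $e_G$), a (row-finite) graph $E$ with no sources, an action of $G$ on $E$, and a map $\varphi\colon G\times E^1\to G$ with $\varphi(gh,e)=\varphi(g,h\cdot e)\varphi(h,e)$ and $\varphi(g,e)\cdot v=g\cdot v$ for all $g,h\in G$, $e\in E^1$, $v\in E^0$. An $E$-family in a $*$-algebra: mutually orthogonal projections $P_v$ ($v\in E^0$) and partial isometries $S_e$ ($e\in E^1$) with $S_e^*S_f=\delta_{e,f}P_{s(e)}$ and $P_v=\sum_{e\in vE^1}S_eS_e^*$.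 A $(G,E)$-family: elements $P_{v,f}$, $S_{e,g}$ ($v\in E^0$, $e\in E^1$, $f,g\in G$) such that (a) $\{P_{v,e_G}\}\cup\{S_{e,e_G}\}$ is an $E$-family; (b) $(P_{v,f})^*=P_{f^{-1}\cdot v,f^{-1}}$; (c) $P_{v,f}P_{w,h}=\delta_{v,f\cdot w}P_{v,fh}$; (d) $P_{v,f}S_{e,g}=\delta_{v,r(f\cdot e)}S_{f\cdot e,\varphi(f,e)g}$; (e) $S_{e,g}P_{v,f}=\delta_{g\cdot v,s(e)}S_{e,gf}$. $L_R(G,E)$ is the universal $*$-algebra over $R$ generated by a $(G,E)$-family. $\mathcal{O}_{(G,E)}^{\text{alg}}(R)$ is the universal (unital) $*$-algebra over $R$ with generators $\{p_v:v\in E^0\}\cup\{s_e:e\in E^1\}\cup\{u^g:g\in G\}$ and relations: $\{p_v\}\cup\{s_e\}$ is an $E$-family; $g\mapsto u^g$ is a unitary representation of $G$ (each $u^g$ is unitary, i.e. $(u^g)^*u^g=u^g(u^g)^*=1$, and $u^gu^h=u^{gh}$; hence $u^{e_G}=1$ and $(u^g)^*=u^{g^{-1}}$); $u^gs_e=s_{g\cdot e}u^{\varphi(g,e)}$ for all $g\in G$, $e\in E^1$; $u^gp_v=p_{g\cdot v}u^g$ for all $g\in G$, $v\in E^0$; and $\sum_{v\in E^0}p_v=u^{e_G}$. *)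

(* Defs.v *)
From HB Require Import structures.
From mathcomp Require Import all_boot all_algebra.
From mathcomp Require Import boolp classical_sets cardinality.

Set Implicit Arguments.
Unset Strict Implicit.
Unset Printing Implicit Defensive.

Import GRing.Theory.
Local Open Scope ring_scope.

Reserved Notation "a ** b" (at level 40, left associativity).

(* *-algebras over R, for R with the trivial involution r^* = r: associative,
   not necessarily commutative or unital. The algebra structures of MathComp
   are unital and nontrivial, hence cannot be used here. *)
HB.mixin Record Lmodule_isStarAlgebra (R : comPzRingType) A
    of GRing.Lmodule R A := {
  smul : A -> A -> A;
  star : A -> A;
  smulA : associative smul;
  smulDl : left_distributive smul +%R;
  smulDr : right_distributive smul +%R;
  scale_smull : forall (r : R) (a b : A), smul (r *: a) b = r *: smul a b;
  scale_smulr : forall (r : R) (a b : A), smul a (r *: b) = r *: smul a b;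
  starK : involutive star;
  starM : forall a b : A, star (smul a b) = smul (star b) (star a);
  star_linear : forall (r : R) (a b : A),
    star (r *: a + b) = r *: star a + star b
}.

#[short(type="starAlgType")]
HB.structure Definition StarAlgebra (R : comPzRingType) :=
  {A of GRing.Lmodule R A & Lmodule_isStarAlgebra R A}.

Notation "a ** b" := (smul a b) : ring_scope.

Section StarAlgebraTheory.
Variables (R : comPzRingType).

Definition star_morphism (A B : starAlgType R) (h : A -> B) : Prop :=
  [/\ forall (r : R) (a b : A), h (r *: a + b) = r *: h a + h b,
      forall a b : A, h (a ** b) = h a ** h b
    & forall a : A, h (star a) = star (h a)].

Definition star_isomorphic (A B : starAlgType R) : Prop :=
  exists h : A -> B, star_morphism h /\ bijective h.

Definition projection (A : starAlgType R) (p : A) : Prop :=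
  p = star p /\ p = p ** p.

Definition partial_isometry (A : starAlgType R) (s : A) : Prop :=
  s = s ** star s ** s.

Definition is_identity (A : starAlgType R) (one : A) : Prop :=
  forall a : A, one ** a = a /\ a ** one = a.

Lemma starD (A : starAlgType R) (a b : A) : star (a + b) = star a + star b.
Proof. by have := star_linear 1 a b; rewrite !scale1r. Qed.

Lemma star0 (A : starAlgType R) : star (0 : A) = 0.
Proof. by apply: (addIr (star (0 : A))); rewrite -starD !add0r. Qed.

Lemma starZ (A : starAlgType R) (r : R) (a : A) : star (r *: a) = r *: star a.
Proof. by have := star_linear r a 0; rewrite star0 !addr0. Qed.

End StarAlgebraTheory.

(* The universal *-algebra over R generated by a family (f x)_(x : X) subject
   to a predicate C: *-algebra expressions in the generators, where two
   expressions are identified when they take the same value on every family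
   satisfying C in every *-algebra. See [universal] and [univ_alg_universal]. *)
Section UniversalStarAlgebra.
Variables (R : comPzRingType) (X : Type).

Inductive term : Type :=
  | TGen of X
  | TZero
  | TAdd of term & term
  | TScale of R & term
  | TMul of term & term
  | TStar of term.

HB.instance Definition _ := gen_eqMixin term.
HB.instance Definition _ := gen_choiceMixin term.

Fixpoint eval (A : starAlgType R) (f : X -> A) (t : term) : A :=
  match t with
  | TGen x => f x
  | TZero => 0
  | TAdd t1 t2 => eval f t1 + eval f t2
  | TScale r t1 => r *: eval f t1
  | TMul t1 t2 => eval f t1 ** eval f t2
  | TStar t1 => star (eval f t1)
  end.

Variable C : forall A : starAlgType R, (X -> A) -> Prop.

Definition term_eq (t1 t2 : term) : bool :=
  `[< forall (A : starAlgType R) (f : X -> A), C f -> eval f t1 = eval f t2 >].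

Lemma term_eq_refl : reflexive term_eq.
Proof. by move=> t; apply/asboolP. Qed.

Lemma term_eq_sym : symmetric term_eq.
Proof. by move=> s t; apply/asboolP/asboolP => H A f /H. Qed.

Lemma term_eq_trans : transitive term_eq.
Proof.
by move=> t s u /asboolP H /asboolP K; apply/asboolP => A f Cf; rewrite H ?K.
Qed.

Canonical term_equiv := EquivRel term_eq term_eq_refl term_eq_sym term_eq_trans.

Definition univ_alg : Type := {eq_quot term_equiv}%qT.
HB.instance Definition _ := Choice.on univ_alg.

Definition univ_class (t : term) : univ_alg := (\pi_({eq_quot term_equiv}) t)%qT.
Definition univ_repr (a : univ_alg) : term :=
  repr (a : {eq_quot term_equiv}%qT).
Definition univ_gen (x : X) : univ_alg := univ_class (TGen x).

Definition univ_eval (A : starAlgType R) (f : X -> A) (a : univ_alg) : A :=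
  eval f (univ_repr a).

Lemma univ_eval_class (A : starAlgType R) (f : X -> A) t :
  C f -> univ_eval f (univ_class t) = eval f t.
Proof.
move=> Cf; rewrite /univ_eval.
suff /asboolP : term_eq (univ_repr (univ_class t)) t by exact.
by apply/eqmodP; rewrite /univ_repr reprK.
Qed.

Lemma univ_ext (a b : univ_alg) :
  (forall (A : starAlgType R) (f : X -> A), C f ->
     univ_eval f a = univ_eval f b) -> a = b.
Proof.
move=> H; rewrite -[a]reprK -[b]reprK; apply/eqmodP; apply/asboolP.
by move=> A f /H.
Qed.

Definition univ_zero := univ_class TZero.
Definition univ_add a b := univ_class (TAdd (univ_repr a) (univ_repr b)).
Definition univ_scale r a := univ_class (TScale r (univ_repr a)).
Definition univ_opp := univ_scale (- 1).
Definition univ_mul a b := univ_class (TMul (univ_repr a) (univ_repr b)).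
Definition univ_star a := univ_class (TStar (univ_repr a)).

Lemma univ_evalE (A : starAlgType R) (f : X -> A) : C f ->
  (univ_eval f univ_zero = 0) *
  (forall a b, univ_eval f (univ_add a b) = (univ_eval f a + univ_eval f b)%R) *
  (forall r a, univ_eval f (univ_scale r a) = r *: univ_eval f a) *
  (forall a, univ_eval f (univ_opp a) = - univ_eval f a) *
  (forall a b, univ_eval f (univ_mul a b) = univ_eval f a ** univ_eval f b) *
  (forall a, univ_eval f (univ_star a) = star (univ_eval f a)).
Proof.
move=> Cf; do !split; move=> *; rewrite univ_eval_class //=.
by rewrite scaleN1r.
Qed.

Local Ltac univ_by tac :=
  hnf; intros; apply: univ_ext;
  let A := fresh in let f := fresh in let Cf := fresh in
  intros A f Cf; rewrite !(univ_evalE Cf); tac.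

Lemma univ_addA : associative univ_add.
Proof. by univ_by ltac:(rewrite addrA). Qed.
Lemma univ_addC : commutative univ_add.
Proof. by univ_by ltac:(rewrite addrC). Qed.
Lemma univ_add0 : left_id univ_zero univ_add.
Proof. by univ_by ltac:(rewrite add0r). Qed.
Lemma univ_addN : left_inverse univ_zero univ_opp univ_add.
Proof. by univ_by ltac:(rewrite addNr). Qed.

HB.instance Definition _ :=
  GRing.isZmodule.Build univ_alg univ_addA univ_addC univ_add0 univ_addN.

Lemma univ_scaleA r s a : univ_scale r (univ_scale s a) = univ_scale (r * s)%R a.
Proof. by univ_by ltac:(rewrite scalerA). Qed.
Lemma univ_scale1 : left_id 1 univ_scale.
Proof. by univ_by ltac:(rewrite scale1r). Qed.
Lemma univ_scaleDr : right_distributive univ_scale univ_add.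
Proof. by univ_by ltac:(rewrite scalerDr). Qed.
Lemma univ_scaleDl a : {morph univ_scale^~ a : r s / r + s >-> univ_add r s}.
Proof. by univ_by ltac:(rewrite scalerDl). Qed.

HB.instance Definition _ :=
  GRing.Zmodule_isLmodule.Build R univ_alg
    univ_scaleA univ_scale1 univ_scaleDr univ_scaleDl.

Lemma univ_mulA : associative univ_mul.
Proof. by univ_by ltac:(rewrite smulA). Qed.
Lemma univ_mulDl : left_distributive univ_mul univ_add.
Proof. by univ_by ltac:(rewrite smulDl). Qed.
Lemma univ_mulDr : right_distributive univ_mul univ_add.
Proof. by univ_by ltac:(rewrite smulDr). Qed.
Lemma univ_scale_mull r a b :
  univ_mul (univ_scale r a) b = univ_scale r (univ_mul a b).
Proof. by univ_by ltac:(rewrite scale_smull). Qed.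
Lemma univ_scale_mulr r a b :
  univ_mul a (univ_scale r b) = univ_scale r (univ_mul a b).
Proof. by univ_by ltac:(rewrite scale_smulr). Qed.
Lemma univ_starK : involutive univ_star.
Proof. by univ_by ltac:(rewrite starK). Qed.
Lemma univ_starM a b :
  univ_star (univ_mul a b) = univ_mul (univ_star b) (univ_star a).
Proof. by univ_by ltac:(rewrite starM). Qed.
Lemma univ_star_linear r a b :
  univ_star (univ_add (univ_scale r a) b) =
  univ_add (univ_scale r (univ_star a)) (univ_star b).
Proof. by univ_by ltac:(rewrite star_linear). Qed.

HB.instance Definition _ :=
  Lmodule_isStarAlgebra.Build R univ_alg
    univ_mulA univ_mulDl univ_mulDr univ_scale_mull univ_scale_mulr
    univ_starK univ_starM univ_star_linear.

Section Eval.
Variables (A : starAlgType R) (f : X -> A) (Cf : C f).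

Lemma univ_evalG x : univ_eval f (univ_gen x) = f x.
Proof. by rewrite univ_eval_class. Qed.

Lemma univ_eval0 : univ_eval f 0 = 0.
Proof. by rewrite [LHS]univ_eval_class. Qed.

Lemma univ_evalD : {morph univ_eval f : a b / a + b}.
Proof. by move=> a b; rewrite [LHS]univ_eval_class. Qed.

Lemma univ_evalZ r : {morph univ_eval f : a / r *: a}.
Proof. by move=> a; rewrite [LHS]univ_eval_class. Qed.

Lemma univ_evalM : {morph univ_eval f : a b / a ** b}.
Proof. by move=> a b; rewrite [LHS]univ_eval_class. Qed.

Lemma univ_evalS : {morph univ_eval f : a / star a}.
Proof. by move=> a; rewrite [LHS]univ_eval_class. Qed.

Lemma univ_eval_sum (I : finType) (P : pred I) (F : I -> univ_alg) :
  univ_eval f (\sum_(i | P i) F i) = \sum_(i | P i) univ_eval f (F i).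
Proof. exact: (big_morph _ univ_evalD univ_eval0). Qed.

Lemma univ_eval_if (b : bool) (u v : univ_alg) :
  univ_eval f (if b then u else v) = if b then univ_eval f u else univ_eval f v.
Proof. by case: b. Qed.

End Eval.

Definition universal (A : starAlgType R) (f : X -> A) : Prop :=
  C f /\
  forall (B : starAlgType R) (g : X -> B), C g ->
    exists! h : A -> B, star_morphism h /\ forall x : X, h (f x) = g x.

Lemma univ_classE t : univ_class t = eval univ_gen t.
Proof.
apply: univ_ext => A f Cf; rewrite univ_eval_class //.
elim: t => [x||t1 IH1 t2 IH2|r t IH|t1 IH1 t2 IH2|t IH] /=.
- by rewrite univ_evalG.
- by rewrite univ_eval0.
- by rewrite univ_evalD // IH1 IH2.
- by rewrite univ_evalZ // IH.
- by rewrite univ_evalM // IH1 IH2.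
- by rewrite univ_evalS // IH.
Qed.

Lemma star_morphism_eval (A B : starAlgType R) (f : X -> A) (h : A -> B) t :
  star_morphism h -> h (eval f t) = eval (h \o f) t.
Proof.
case=> hL hM hS.
have hD a b : h (a + b) = h a + h b.
  by have := hL 1 a b; rewrite !scale1r.
have h0 : h 0 = 0 by apply: (addIr (h 0)); rewrite -hD !add0r.
have hZ r a : h (r *: a) = r *: h a.
  by have := hL r a 0; rewrite h0 !addr0.
elim: t => [x||t1 IH1 t2 IH2|r t IH|t1 IH1 t2 IH2|t IH] //=.
- by rewrite hD IH1 IH2.
- by rewrite hZ IH.
- by rewrite hM IH1 IH2.
- by rewrite hS IH.
Qed.

Lemma univ_alg_universal : C univ_gen -> universal univ_gen.
Proof.
move=> CG; split=> // B g Cg; exists (univ_eval g); split.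
  split; last exact: univ_evalG.
  split; [|exact: univ_evalM|exact: univ_evalS].
  by move=> r a b; rewrite univ_evalD // univ_evalZ.
move=> h [hm hg]; apply/funext => a.
have -> : a = eval univ_gen (univ_repr a) by rewrite -univ_classE [RHS]reprK.
rewrite (star_morphism_eval _ _ hm) -univ_classE univ_eval_class //.
by congr eval; apply/funext => x; rewrite /= hg.
Qed.

End UniversalStarAlgebra.

Record finite_graph := FiniteGraph {
  vert : finType;
  edge : finType;
  rng : edge -> vert;
  src : edge -> vert
}.

Section SelfSimilar.
Variables (G : groupType) (E : finite_graph).

(* An action of G on E by bijections of the disjoint union of vertices and
   edges preserving both parts is an action on each part; row-finiteness is
   automatic as E is finite. *)
Record self_similar_triple := SelfSimilarTriple {
  countable_group : countable [set: G];
  no_sources : forall v : vert E, exists e : edge E, rng e = v;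
  vact : G -> vert E -> vert E;
  eact : G -> edge E -> edge E;
  vact1 : forall v, vact 1%g v = v;
  vactM : forall g h v, vact (g * h)%g v = vact g (vact h v);
  eact1 : forall e, eact 1%g e = e;
  eactM : forall g h e, eact (g * h)%g e = eact g (eact h e);
  rng_act : forall g e, rng (eact g e) = vact g (rng e);
  src_act : forall g e, src (eact g e) = vact g (src e);
  phi : G -> edge E -> G;
  phiM : forall g h e, phi (g * h)%g e = (phi g (eact h e) * phi h e)%g;
  phi_vact : forall g e v, vact (phi g e) v = vact g v
}.

End SelfSimilar.

Section Families.
Variables (G : groupType) (E : finite_graph) (T : self_similar_triple G E).
Variables (R : comPzRingType).

Record E_family (A : starAlgType R) (P : vert E -> A) (S : edge E -> A) : Prop :=
  EFamily {
  E_proj : forall v, projection (P v);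
  E_orth : forall v w, v != w -> P v ** P w = 0;
  E_piso : forall e, partial_isometry (S e);
  E_starS : forall e f, star (S e) ** S f = if e == f then P (src e) else 0;
  E_sum : forall v, P v = \sum_(e : edge E | rng e == v) S e ** star (S e)
}.

Record GE_family (A : starAlgType R)
    (P : vert E -> G -> A) (S : edge E -> G -> A) : Prop := GEFamily {
  GE_E : E_family (fun v => P v 1%g) (fun e => S e 1%g);
  GE_starP : forall v f, star (P v f) = P (vact T f^-1%g v) f^-1%g;
  GE_PP : forall v f w h,
    P v f ** P w h = if v == vact T f w then P v (f * h)%g else 0;
  GE_PS : forall v f e g,
    P v f ** S e g =
      if v == rng (eact T f e) then S (eact T f e) (phi T f e * g)%g else 0;
  GE_SP : forall e g v f,
    S e g ** P v f = if vact T g v == src e then S e (g * f)%g else 0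
}.

Inductive L_gen : Type :=
  | Lp of vert E & G
  | Ls of edge E & G.

Definition L_rel (A : starAlgType R) (f : L_gen -> A) : Prop :=
  GE_family (fun v g => f (Lp v g)) (fun e g => f (Ls e g)).

(* The unit is a generator required to be an identity, so that the universal
   object and its comparison morphisms are those of unital *-algebras. *)
Record O_family (A : starAlgType R) (one : A)
    (p : vert E -> A) (s : edge E -> A) (u : G -> A) : Prop := OFamily {
  O_one : is_identity one;
  O_E : E_family p s;
  O_unitary : forall g, star (u g) ** u g = one /\ u g ** star (u g) = one;
  O_uM : forall g h, u g ** u h = u (g * h)%g;
  O_us : forall g e, u g ** s e = s (eact T g e) ** u (phi T g e);
  O_up : forall g v, u g ** p v = p (vact T g v) ** u g;
  O_sum : \sum_(v : vert E) p v = u 1%g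
}.

Inductive O_gen : Type :=
  | Oone
  | Op of vert E
  | Os of edge E
  | Ou of G.

Definition O_rel (A : starAlgType R) (f : O_gen -> A) : Prop :=
  O_family (f Oone) (fun v => f (Op v)) (fun e => f (Os e)) (fun g => f (Ou g)).

Definition L_alg : starAlgType R := univ_alg L_rel.
Definition O_alg : starAlgType R := univ_alg O_rel.

Lemma E_family_lift (X : Type) (C : forall A : starAlgType R, (X -> A) -> Prop)
    (P : vert E -> univ_alg C) (S : edge E -> univ_alg C) :
  (forall (A : starAlgType R) (f : X -> A), C A f ->
     E_family (fun v => univ_eval f (P v)) (fun e => univ_eval f (S e))) ->
  E_family P S.
Proof.
move=> H; split.
- by move=> v; split; apply: univ_ext => A f Cf;
    rewrite ?univ_evalS ?univ_evalM //; have [/(_ v) []] := H A f Cf.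
- move=> v w vw; apply: univ_ext => A f Cf.
  by rewrite univ_evalM // univ_eval0 // (E_orth (H A f Cf)).
- move=> e; apply: univ_ext => A f Cf.
  by rewrite !univ_evalM // univ_evalS //; apply: (E_piso (H A f Cf)).
- move=> e e'; apply: univ_ext => A f Cf.
  by rewrite univ_evalM // univ_evalS // univ_eval_if univ_eval0 //
    (E_starS (H A f Cf)).
- move=> v; apply: univ_ext => A f Cf.
  rewrite univ_eval_sum // (E_sum (H A f Cf)); apply: eq_bigr => e _.
  by rewrite univ_evalM // univ_evalS.
Qed.

Lemma L_alg_universal : universal L_rel (@univ_gen R L_gen L_rel).
Proof.
apply: univ_alg_universal; split.
- apply: E_family_lift => A f Cf; have [CE _ _ _ _] := Cf.
  have fE x : univ_eval f (univ_gen L_rel x) = f x by exact: univ_evalG.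
  by under eq_fun do rewrite fE; under [X in E_family _ X]eq_fun do rewrite fE.
- move=> v g; apply: univ_ext => A f Cf.
  by rewrite univ_evalS // !univ_evalG // (GE_starP Cf).
- move=> v g w h; apply: univ_ext => A f Cf.
  by rewrite univ_evalM // univ_eval_if univ_eval0 // !univ_evalG // (GE_PP Cf).
- move=> v g e h; apply: univ_ext => A f Cf.
  by rewrite univ_evalM // univ_eval_if univ_eval0 // !univ_evalG // (GE_PS Cf).
- move=> e g v h; apply: univ_ext => A f Cf.
  by rewrite univ_evalM // univ_eval_if univ_eval0 // !univ_evalG // (GE_SP Cf).
Qed.

Lemma O_alg_universal : universal O_rel (@univ_gen R O_gen O_rel).
Proof.
apply: univ_alg_universal; split.
- move=> a; split; apply: univ_ext => A f Cf; rewrite univ_evalM // univ_evalG //;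
    by have [e1 e2] := O_one Cf (univ_eval f a); rewrite ?e1 ?e2.
- apply: E_family_lift => A f Cf; have [_ CE _ _ _ _ _] := Cf.
  have fE x : univ_eval f (univ_gen O_rel x) = f x by exact: univ_evalG.
  by under eq_fun do rewrite fE; under [X in E_family _ X]eq_fun do rewrite fE.
- move=> g; split; apply: univ_ext => A f Cf;
    rewrite univ_evalM // univ_evalS // !univ_evalG //;
    by have [e1 e2] := O_unitary Cf g; rewrite ?e1 ?e2.
- move=> g h; apply: univ_ext => A f Cf.
  by rewrite univ_evalM // !univ_evalG // (O_uM Cf).
- move=> g e; apply: univ_ext => A f Cf.
  by rewrite !univ_evalM // !univ_evalG // (O_us Cf).
- move=> g v; apply: univ_ext => A f Cf.
  by rewrite !univ_evalM // !univ_evalG // (O_up Cf).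
- apply: univ_ext => A f Cf.
  rewrite univ_eval_sum // univ_evalG // -(O_sum Cf).
  by apply: eq_bigr => v _; rewrite univ_evalG.
Qed.

End Families.

(* Main.v *)
Require Import Defs.
From HB Require Import structures.
From mathcomp Require Import all_boot all_algebra.
From mathcomp Require Import boolp classical_sets cardinality.

(** An [O_family] [(p, s, u)] gives the [(G, E)]-family [P_{v,f} = p_v u^f],
    [S_{e,g} = s_e u^g]; conversely a [(G, E)]-family gives [p_v = P_{v,1}],
    [s_e = S_{e,1}], [u^g = \sum_v P_{v,g}].  In an arbitrary *-algebra the
    element [\sum_v P_{v,1}] need not be an identity, but it acts as one on the
    generators [P_{v,f}], [S_{e,g}], hence on the whole of [L_R(G, E)].  The two
    constructions are mutually inverse on generators. *)

Set Implicit Arguments.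
Unset Strict Implicit.
Unset Printing Implicit Defensive.

Import GRing.Theory.
Local Open Scope ring_scope.

(** * Zero and finite sums in non-unital *-algebras *)

Section StarAlgebraLemmas.
Variables (R : comPzRingType) (A : starAlgType R).

Lemma smul0l (a : A) : 0 ** a = 0.
Proof. by have := scale_smull 0 0 a; rewrite !scale0r. Qed.

Lemma smul0r (a : A) : a ** 0 = 0.
Proof. by have := scale_smulr 0 a 0; rewrite !scale0r. Qed.

Lemma smul_suml (I : finType) (P : pred I) (F : I -> A) (a : A) :
  (\sum_(i | P i) F i) ** a = \sum_(i | P i) F i ** a.
Proof. by apply: (big_morph (smul^~ a)); [move=> ? ?; exact: smulDl|exact: smul0l]. Qed.

Lemma smul_sumr (I : finType) (P : pred I) (F : I -> A) (a : A) :
  a ** (\sum_(i | P i) F i) = \sum_(i | P i) a ** F i.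
Proof. by apply: (big_morph (smul a)); [move=> ? ?; exact: smulDr|exact: smul0r]. Qed.

Lemma star_sum (I : finType) (P : pred I) (F : I -> A) :
  star (\sum_(i | P i) F i) = \sum_(i | P i) star (F i).
Proof. by apply: (big_morph star); [exact: starD|exact: star0]. Qed.

End StarAlgebraLemmas.

(** * Reduction of statements on a universal algebra to its generators *)

Section UniversalLemmas.
Variables (R : comPzRingType) (X : Type).
Variable C : forall A : starAlgType R, (X -> A) -> Prop.

Lemma univ_reprE (a : univ_alg C) : eval (univ_gen C) (univ_repr a) = a.
Proof. by rewrite -univ_classE; exact: (@reprK _ (univ_alg C)). Qed.

Lemma univ_eval_morphism (A : starAlgType R) (f : X -> A) :
  C f -> star_morphism (univ_eval f : univ_alg C -> A).
Proof.
move=> Cf; split; [|exact: univ_evalM|exact: univ_evalS].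
by move=> r a b; rewrite univ_evalD // univ_evalZ.
Qed.

Lemma univ_morphism_ext (A : starAlgType R) (h k : univ_alg C -> A) :
  star_morphism h -> star_morphism k ->
  (forall x, h (univ_gen C x) = k (univ_gen C x)) -> h =1 k.
Proof.
move=> hm km hk a; rewrite -(univ_reprE a).
rewrite (star_morphism_eval _ _ hm) (star_morphism_eval _ _ km).
by congr eval; apply/funext.
Qed.

(** Induction on a term representing the element. Both sides are treated together because the star
    case exchanges them: since [one] is self-adjoint, [one ** star a] is [star (a ** one)]. *)
Lemma univ_is_identity (one : univ_alg C) : star one = one ->
  (forall x, one ** univ_gen C x = univ_gen C x /\
             univ_gen C x ** one = univ_gen C x) ->
  is_identity one.
Proof.
move=> ones onex a; rewrite -(univ_reprE a).
elim: (univ_repr a) => [x||t1 [l1 r1] t2 [l2 r2]|c t [l r]|t1 [l1 r1] t2 [l2 r2]|t [l r]] /=.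
- exact: onex.
- by rewrite smul0l smul0r.
- by rewrite smulDl smulDr l1 l2 r1 r2.
- by rewrite scale_smull scale_smulr l r.
- by rewrite smulA l1 -smulA r2.
- by rewrite -{1}ones -{2}ones -!starM l r.
Qed.

End UniversalLemmas.

Lemma star_morphism_id (R : comPzRingType) (A : starAlgType R) :
  star_morphism (@id A).
Proof. by []. Qed.

Lemma star_morphism_comp (R : comPzRingType) (A B D : starAlgType R)
    (h : B -> D) (k : A -> B) :
  star_morphism h -> star_morphism k -> star_morphism (h \o k).
Proof.
case=> hL hM hS [kL kM kS].
by split=> *; rewrite /= ?kL ?kM ?kS ?hL ?hM ?hS.
Qed.

Section Families.
Variables (G : groupType) (E : finite_graph) (T : self_similar_triple G E).
Variables (R : comPzRingType).

Lemma vactK g : cancel (vact T g) (vact T g^-1%g).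
Proof. by move=> v; rewrite -vactM mulVg vact1. Qed.

Lemma vactVK g : cancel (vact T g^-1%g) (vact T g).
Proof. by move=> v; rewrite -vactM mulgV vact1. Qed.

(** The cocycle identity at [g = h = 1] makes this element idempotent, and the only idempotent of a
    group is 1. *)
Lemma phi1 e : phi T 1%g e = 1%g.
Proof. by apply: (mulgI (phi T 1%g e)); rewrite mulg1 -{1}(eact1 T e) -phiM mulg1. Qed.

(** * Products of vertex projections and edges in an E-family *)

Section EFamily.
Variables (A : starAlgType R) (p : vert E -> A) (s : edge E -> A).
Hypothesis Eps : E_family p s.

Lemma E_ps v e : p v ** s e = if v == rng e then s e else 0.
Proof.
have pr : p (rng e) ** s e = s e.
  (* In the sum of [s f ** star (s f) ** s e], the term [f = e] is [s e] and the others vanish by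
     orthogonality. *)
  rewrite (E_sum Eps) smul_suml (bigD1 e) //= -(E_piso Eps).
  rewrite big1 ?addr0 // => f /andP[_ /negPf fe].
  by rewrite -smulA (E_starS Eps) fe smul0r.
case: eqP => [-> //|/eqP vr].
by rewrite -pr smulA (E_orth Eps vr) smul0l.
Qed.

Lemma E_sp v e : s e ** p v = if v == src e then s e else 0.
Proof.
have sr : s e ** p (src e) = s e.
  by rewrite [RHS](E_piso Eps) -smulA (E_starS Eps) eqxx.
case: eqP => [-> //|/eqP vr].
by rewrite -sr -smulA (E_orth Eps) ?smul0r // eq_sym.
Qed.

Lemma E_pp v w : p v ** p w = if v == w then p v else 0.
Proof.
case: eqP => [<-|/eqP /(E_orth Eps)//].
by have [_ <-] := E_proj Eps v.
Qed.

End EFamily.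

(** * From an O-family to a (G,E)-family *)

Section FromO.
Variables (A : starAlgType R) (one : A).
Variables (p : vert E -> A) (s : edge E -> A) (u : G -> A).
Hypothesis O : O_family T one p s u.

(** An idempotent unitary is the identity. *)
Lemma O_u1 : u 1%g = one.
Proof.
have [uu _] := O_unitary O 1%g; have [ou _] := O_one O (u 1%g).
by rewrite -ou -uu -smulA (O_uM O) mulg1.
Qed.

Lemma O_mulu1 a : a ** u 1%g = a.
Proof. by rewrite O_u1; have [] := O_one O a. Qed.

Lemma O_star_u g : star (u g) = u g^-1%g.
Proof.
have [uu _] := O_unitary O g.
by rewrite -[LHS]O_mulu1 -(mulgV g) -(O_uM O) smulA uu; have [] := O_one O (u g^-1%g).
Qed.

(** In each product [O_up] or [O_us] moves the inner unitary to the right, where it merges with the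
    other one; the Kronecker delta then comes from the E-family alone. *)
Lemma O_GE_family : GE_family T (fun v g => p v ** u g) (fun e g => s e ** u g).
Proof.
have Eps := O_E O.
split.
- under eq_fun do rewrite O_mulu1.
  by under [X in E_family _ X]eq_fun do rewrite O_mulu1.
- move=> v f; rewrite starM O_star_u -(O_up O).
  by have [<- _] := E_proj Eps v.
- move=> v f w h; rewrite smulA -(smulA (p v)) (O_up O) smulA (E_pp Eps).
  by case: eqP => [_|_]; rewrite ?smul0l // -smulA (O_uM O).
- move=> v f e g; rewrite smulA -(smulA (p v)) (O_us O) smulA (E_ps Eps).
  by case: eqP => [_|_]; rewrite ?smul0l // -smulA (O_uM O).
- move=> e g v f; rewrite smulA -(smulA (s e)) (O_up O) smulA (E_sp Eps).
  by case: eqP => [_|_]; rewrite ?smul0l // -smulA (O_uM O).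
Qed.

End FromO.

(** * From a (G,E)-family to an O-family *)

Section FromGE.
Variables (A : starAlgType R) (P : vert E -> G -> A) (S : edge E -> G -> A).
Hypothesis GE : GE_family T P S.

Definition GE_u (g : G) : A := \sum_(v : vert E) P v g.

Lemma GE_uP g w h : GE_u g ** P w h = P (vact T g w) (g * h)%g.
Proof.
rewrite smul_suml; under eq_bigr do rewrite (GE_PP GE).
by rewrite -big_mkcond big_pred1_eq.
Qed.

Lemma GE_Pu v g h : P v g ** GE_u h = P v (g * h)%g.
Proof.
rewrite smul_sumr; under eq_bigr do rewrite (GE_PP GE).
(* The delta requires [v = vact T g w], so exactly one [w] contributes. *)
rewrite -big_mkcond (big_pred1 (vact T g^-1%g v)) // => w /=.
by rewrite eq_sym (can2_eq (vactK g) (vactVK g)).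
Qed.

Lemma GE_uS g e h : GE_u g ** S e h = S (eact T g e) (phi T g e * h)%g.
Proof.
rewrite smul_suml; under eq_bigr do rewrite (GE_PS GE).
by rewrite -big_mkcond big_pred1_eq.
Qed.

Lemma GE_Su e g h : S e g ** GE_u h = S e (g * h)%g.
Proof.
rewrite smul_sumr; under eq_bigr do rewrite (GE_SP GE).
rewrite -big_mkcond (big_pred1 (vact T g^-1%g (src e))) // => w /=.
by rewrite (can2_eq (vactK g) (vactVK g)).
Qed.

Lemma GE_star_u g : star (GE_u g) = GE_u g^-1%g.
Proof.
rewrite star_sum; under eq_bigr do rewrite (GE_starP GE).
(* The star turns the index [v] into its translate by the inverse of [g], which only permutes the
   vertices. *)
by rewrite [RHS](reindex_inj (can_inj (vactVK g))).
Qed.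

Lemma GE_uM g h : GE_u g ** GE_u h = GE_u (g * h)%g.
Proof. by rewrite smul_suml; apply: eq_bigr => v _; rewrite GE_Pu. Qed.

Lemma GE_O_family : is_identity (GE_u 1%g) ->
  O_family T (GE_u 1%g) (P^~ 1%g) (S^~ 1%g) GE_u.
Proof.
move=> one1; split=> //.
- exact: GE_E GE.
- by move=> g; rewrite GE_star_u !GE_uM mulVg mulgV.
- exact: GE_uM.
- by move=> g e; rewrite GE_uS GE_Su mulg1 mul1g.
- by move=> g v; rewrite GE_uP GE_Pu mulg1 mul1g.
Qed.

End FromGE.

(** [Oone] and [Ou 1] must get the same value, since a unitary representation sends 1 to the
    identity. *)
Definition O_of_L (A : starAlgType R) (f : L_gen G E -> A) (x : O_gen G E) : A :=
  match x with
  | Oone => GE_u (fun v g => f (Lp v g)) 1%g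
  | Op v => f (Lp v 1%g)
  | Os e => f (Ls e 1%g)
  | Ou g => GE_u (fun v h => f (Lp v h)) g
  end.

Definition L_of_O (A : starAlgType R) (f : O_gen G E -> A) (x : L_gen G E) : A :=
  match x with
  | Lp v g => f (Op G v) ** f (Ou E g)
  | Ls e g => f (Os G e) ** f (Ou E g)
  end.

Lemma L_of_O_rel (A : starAlgType R) (f : O_gen G E -> A) :
  O_rel T f -> L_rel T (L_of_O f).
Proof. exact: O_GE_family. Qed.

Lemma L_alg_identity :
  is_identity (O_of_L (univ_gen (@L_rel G E T R)) (Oone G E)).
Proof.
have [GE _] := L_alg_universal T R.
apply: univ_is_identity => [|[v g|e g]] /=.
- by rewrite (GE_star_u GE) invg1.
- by rewrite (GE_uP GE) (GE_Pu GE) vact1 mul1g mulg1.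
- by rewrite (GE_uS GE) (GE_Su GE) eact1 phi1 mul1g mulg1.
Qed.

Lemma O_of_L_rel : O_rel T (O_of_L (univ_gen (@L_rel G E T R))).
Proof.
have [GE _] := L_alg_universal T R.
exact: GE_O_family GE L_alg_identity.
Qed.

End Families.

Theorem proposition1p9 (G : groupType) (E : finite_graph)
    (T : self_similar_triple G E) (R : comPzRingType) :
  star_isomorphic (O_alg T R) (L_alg T R).
Proof.
have [GE _] := L_alg_universal T R.
have [O _] := O_alg_universal T R.
(* Each universal family yields a family of the other kind, so evaluation at it is a morphism. *)
have CO := O_of_L_rel T R; have CL := L_of_O_rel O.
pose h : O_alg T R -> L_alg T R := univ_eval (O_of_L (univ_gen (@L_rel G E T R))).
pose k : L_alg T R -> O_alg T R := univ_eval (L_of_O (univ_gen (@O_rel G E T R))).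
have hm : star_morphism h := univ_eval_morphism CO.
have km : star_morphism k := univ_eval_morphism CL.
have hE x : h (univ_gen _ x) = O_of_L (univ_gen _) x by exact: univ_evalG.
have kE x : k (univ_gen _ x) = L_of_O (univ_gen _) x by exact: univ_evalG.
exists h; split=> //; exists k.
- apply: (univ_morphism_ext (star_morphism_comp km hm) (star_morphism_id _)).
  (* The image is the sum of all [p_v u^g], which the relation [O_sum] collapses to [u^1 u^g]. *)
  have ku g : k (h (univ_gen _ (Ou E g))) = univ_gen _ (Ou E g).
    rewrite hE /= /k univ_eval_sum //.
    under eq_bigr do rewrite [univ_eval _ _]kE /=.
    by rewrite -smul_suml (O_sum O) (O_uM O) mul1g.
  move=> [|v|e|g] //=.
  (* The unit generator reduces to the case of [u^1], which equals it in the universal algebra. *)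
  + have -> : h (univ_gen _ (Oone G E)) = h (univ_gen _ (Ou E 1%g)) by rewrite !hE.
    by rewrite ku (O_u1 O).
  + by rewrite hE kE /= (O_mulu1 O).
  + by rewrite hE kE /= (O_mulu1 O).
- apply: (univ_morphism_ext (star_morphism_comp hm km) (star_morphism_id _)).
  have [_ hM _] := hm.
  (* The images are [P_{v,1}] and [S_{e,1}] times [GE_u g], which restores the group index. *)
  move=> [v g|e g] /=; rewrite kE /= hM !hE /=.
  + by rewrite (GE_Pu GE) mul1g.
  + by rewrite (GE_Su GE) mul1g.
Qed.
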